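(* Let $\Gamma$ be a finite connected simple graph and let $G(\Gamma)$ be the group defined below. Let $0\le \lambda<\frac12$ and let $N\ge \frac{2|V(\Gamma)|+1}{1-2\lambda}$. Let $h\in G(\Gamma)$ and suppose there are two $(\lambda,N)$-quasi-root decompositions $$h=a_1g_1^{n_1}b_1=a_2g_2^{n_2}b_2$$ such that $g_1$ and $g_2$ are strongly non-split and primitive. Then $g_1$ and $g_2$ are conjugate; more precisely $a_1g_1a_1^{-1}=a_2g_2a_2^{-1}$ and $b_1^{-1}g_1b_1=b_2^{-1}g_2b_2$.
   Context: For a finite simple graph $\Gamma$, $G(\Gamma)=\langle v\in V(\Gamma)\mid [v_i,v_j]=1 \text{ if } \{v_i,v_j\}\notin E(\Gamma)\rangle$ (i.e. generators commute exactly when NOT adjacent; $G(\Gamma)$ is the right-angled Artin group on the complement graph). $|g|$ denotes the word length of $g$ with respect to the generators $V(\Gamma)$; a word is reduced if it is a shortest word representing its element. The support $\mathrm{supp}(g)$ is the set of generators $v$ such that $v$ or $v^{-1}$ appears in a reduced word representing $g$ (well defined). Two elements $g_1,g_2$ disjointly commute if $\mathrm{supp}(g_1)\cap\mathrm{supp}(g_2)=\emptyset$ and every $v_1\in\mathrm{supp}(g_1)$ commutes with every $v_2\in\mathrm{supp}(g_2)$, i.e. $\{v_1,v_2\}\notin E(\Gamma)$. An element $g$ is non-split if $\mathrm{supp}(g)$ spans a connected subgraph of $\Gamma$, and strongly non-split if it is non-split and no generator $v\in V(\Gamma)$ disjointly commutes with $g$. A nontrivial element $g$ is primitive if $g\neq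 u^n$ for all $u\in G(\Gamma)$ and $n\ge 2$. A decomposition $g=g_1\cdots g_k$ is geodesic if $|g|=|g_1|+\cdots+|g_k|$. For $0\le\lambda<\frac12$ and $N\ge 2$, a $(\lambda,N)$-quasi-root decomposition of $h$ is a geodesic decomposition $h=a\cdot g\cdot g\cdots g\cdot b=ag^nb$ (with $n$ factors $g$, i.e. $|h|=|a|+n|g|+|b|$) for some $n\ge N$ and $a,b\in G(\Gamma)$ with $|a|,|b|\le\lambda|h|$; then $g$ is called a $(\lambda,N)$-quasi-root of $h$. *)

(* Defs.v *)
(* Right-angled Artin group G(Gamma) on the complement graph,
   modelled concretely: elements are words in letters (v, true) = v,
   (v, false) = v^-1, up to the equivalence generated by free cancellation
   and swapping adjacent letters whose generators are NOT adjacent in Gamma. *)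
From HB Require Import structures.
From mathcomp Require Import all_boot all_order all_algebra.
From Stdlib Require Import Relation_Operators ClassicalEpsilon.
Set Implicit Arguments. Unset Strict Implicit. Unset Printing Implicit Defensive.

Section RAAG.
Variables (T : finType) (e : rel T).

Definition letter := (T * bool)%type.
Definition word := seq letter.

Inductive step : word -> word -> Prop :=
| st_cancel (u v : word) (x : T) (b : bool) :
    step (u ++ [:: (x, b); (x, ~~ b)] ++ v) (u ++ v)
| st_swap (u v : word) (p q : letter) :
    ~~ e p.1 q.1 -> step (u ++ [:: p; q] ++ v) (u ++ [:: q; p] ++ v).

Definition weq : word -> word -> Prop := clos_refl_sym_trans word step.

Definition winv (w : word) : word := rev (map (fun p => (p.1, ~~ p.2)) w).
Fixpoint wpow (w : word) (n : nat) : word :=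
  if n is n'.+1 then w ++ wpow w n' else [::].

Definition pb (P : Prop) : bool := if excluded_middle_informative P then true else false.

Lemma wlen_ex (w : word) : exists n, pb (exists w', weq w w' /\ size w' = n).
Proof.
exists (size w); rewrite /pb; case: excluded_middle_informative => // H.
by exfalso; apply: H; exists w; split => //; apply: rst_refl.
Qed.
Definition wlen (w : word) : nat := ex_minn (wlen_ex w).

Definition reduced (w : word) : Prop := size w = wlen w.

Definition supp (w : word) : pred T :=
  fun v => pb (exists w', weq w w' /\ reduced w' /\ v \in map fst w').

Definition disj_commute (w1 w2 : word) : Prop :=
  forall v1 v2, supp w1 v1 -> supp w2 v2 -> v1 != v2 /\ ~~ e v1 v2.

Definition non_split (w : word) : Prop :=
  forall x y, supp w x -> supp w y ->
    connect (fun a b => [&& e a b, supp w a & supp w b]) x y.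

Definition strongly_non_split (w : word) : Prop :=
  non_split w /\ forall v : T, ~ disj_commute [:: (v, true)] w.

Definition primitive (w : word) : Prop :=
  ~ weq w [::] /\ forall (u : word) (n : nat), 2 <= n -> ~ weq w (wpow u n).

Local Open Scope ring_scope.
Definition quasi_root_dec (R : realFieldType) (lam : R) (N : nat)
    (h a g b : word) (n : nat) : Prop :=
  [/\ (N <= n)%N, weq h (a ++ wpow g n ++ b),
      wlen h = (wlen a + n * wlen g + wlen b)%N,
      (wlen a)%:R <= lam * (wlen h)%:R & (wlen b)%:R <= lam * (wlen h)%:R].

End RAAG.

(* Main.v *)
(** Reduced words representing the same element differ by commutations only, so
    the two decompositions of [h] are equal traces, and a trace is determined by
    its projections onto the pairs [{x, y}] that are edges or singletons.  Since
    the support of [g1] is connected and dominating, any prefix of [h] lies between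
    [a1 g1^k] and [a1 g1^(k + #|T|)] for some [k]; the bound on [N] then leaves, in
    every projection, an overlap of the two periodic parts of length at least
    [2 max(|g1|, |g2|)], measured in that projection.  Conjugating [g1] and [g2] so
    that both start at the join of the prefixes [a1] and [a2], the overlap shows
    that all projections of the conjugates commute, hence the conjugates commute.
    Connectedness makes their letter counts proportional, so the Euclidean
    algorithm writes them as powers of one trace, and primitivity makes them equal. *)
Require Import Defs.
From mathcomp Require Import all_boot all_order all_algebra.
From Stdlib Require Import Relation_Operators ClassicalEpsilon.
From mathcomp Require Import zify ring lra.
Set Implicit Arguments. Unset Strict Implicit. Unset Printing Implicit Defensive.

(** * Traces: words up to commutation, seen through their projections *)

Section Traces.
Variables (T : finType) (e : rel T).
Hypothesis e_sym : symmetric e.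
Implicit Types (x y z : T) (c l m : letter T) (u v w : word T).

Definition dep x y := (x == y) || e x y.
Definition indep l m := ~~ dep l.1 m.1.
Definition proj x y w : word T := [seq l <- w | (l.1 == x) || (l.1 == y)].
Definition cnt x w := count (fun l => l.1 == x) w.
(* Trace equivalence; see [weq_teq] and [reduced_teq] for its relation to [weq]. *)
Definition teq w w' := forall x y, dep x y -> proj x y w = proj x y w'.

Lemma dep_refl x : dep x x. Proof. by rewrite /dep eqxx. Qed.

Lemma dep_sym x y : dep x y = dep y x.
Proof. by rewrite /dep e_sym eq_sym. Qed.

Lemma indep_sym l m : indep l m = indep m l.
Proof. by rewrite /indep dep_sym. Qed.

Lemma proj_cat x y u v : proj x y (u ++ v) = proj x y u ++ proj x y v.
Proof. exact: filter_cat. Qed.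

Lemma projC x y w : proj x y w = proj y x w.
Proof. by apply: eq_filter => l; rewrite orbC. Qed.

Lemma size_proj x y w :
  size (proj x y w) = cnt x w + (if x == y then 0 else cnt y w).
Proof.
elim: w => [|l w IH] /=; first by case: ifP.
rewrite /cnt /= -/(cnt x w) -/(cnt y w).
have -> : size (if (l.1 == x) || (l.1 == y) then l :: proj x y w else proj x y w)
   = ((l.1 == x) || (l.1 == y)) + size (proj x y w) by case: ifP.
rewrite IH; case: (eqVneq x y) => [->|]; first by rewrite orbb; lia.
by case: (eqVneq l.1 x) => [->|]; case: (eqVneq _ y) => /=; lia.
Qed.

Lemma cnt_cat x u v : cnt x (u ++ v) = cnt x u + cnt x v.
Proof. exact: count_cat. Qed.

Lemma cnt_proj x w : cnt x w = size (proj x x w).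
Proof. by rewrite size_proj eqxx addn0. Qed.

Lemma sum_cnt w : \sum_x cnt x w = size w.
Proof.
elim: w => [|l w IH]; first by rewrite big1.
rewrite /= -IH -[in RHS]add1n (eq_bigr (fun x => (l.1 == x) + cnt x w)) //.
rewrite big_split /= (bigD1 l.1) //= eqxx big1 // => x.
by rewrite eq_sym => /negPf ->.
Qed.

Lemma teq_refl w : teq w w. Proof. by []. Qed.
Lemma teq_sym u v : teq u v -> teq v u.
Proof. by move=> H x y /H. Qed.
Lemma teq_trans v u w : teq u v -> teq v w -> teq u w.
Proof. by move=> H1 H2 x y d; rewrite H1 ?H2. Qed.

Lemma teq_cat u u' v v' : teq u u' -> teq v v' -> teq (u ++ v) (u' ++ v').
Proof. by move=> H1 H2 x y d; rewrite !proj_cat H1 ?H2. Qed.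

Lemma teq_catl u v v' : teq v v' -> teq (u ++ v) (u ++ v').
Proof. exact: teq_cat. Qed.

Lemma teq_cons c v v' : teq v v' -> teq (c :: v) (c :: v').
Proof. exact: (@teq_catl [:: c]). Qed.

Lemma teq_cancel u v v' : teq (u ++ v) (u ++ v') -> teq v v'.
Proof.
by move=> H x y /H; rewrite !proj_cat => /eqP; rewrite eqseq_cat // eqxx => /eqP.
Qed.

Lemma cnt_teq x u v : teq u v -> cnt x u = cnt x v.
Proof. by move=> H; rewrite !cnt_proj H ?dep_refl. Qed.

Lemma size_teq u v : teq u v -> size u = size v.
Proof. by move=> H; rewrite -!sum_cnt; apply: eq_bigr => x _; exact: cnt_teq. Qed.

Lemma proj_indep x y c u : dep x y -> (c.1 == x) || (c.1 == y) ->
  all (indep c) u -> proj x y u = [::].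
Proof.
move=> d cxy /allP iu; apply/eqP; rewrite -size_eq0 size_filter -leqn0 leqNgt.
rewrite -has_count; apply/hasP => -[m /iu]; rewrite /indep => /negP ni mxy; apply: ni.
by case/orP: cxy => /eqP ->; case/orP: mxy => /eqP ->; rewrite ?dep_refl ?d // dep_sym ?d.
Qed.

Lemma teq_move c u v : all (indep c) u -> teq (u ++ c :: v) (c :: u ++ v).
Proof.
move=> iu x y d; rewrite -(cat1s c v) -(cat1s c (u ++ v)) !proj_cat.
case cxy: ((c.1 == x) || (c.1 == y)); first by rewrite (proj_indep d cxy iu).
by rewrite /proj /= cxy.
Qed.

Lemma teq_swap l m v : indep l m -> teq (l :: m :: v) (m :: l :: v).
Proof. by move=> ilm; apply: (@teq_move m [:: l]) => /=; rewrite indep_sym ilm. Qed.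

(** Cut [w] at the first letter with generator [c.1]; the projection to [c.1] alone shows that it is
    [c]. A dependent letter [m] before it would make the projection to [c.1] and [m.1] start with a
    letter other than [c]. *)
Lemma proj_head_split c w :
  (forall x, dep c.1 x -> exists r, proj c.1 x w = c :: r) ->
  exists u v, w = u ++ c :: v /\ all (indep c) u.
Proof.
move=> H; have [r E] := H _ (dep_refl c.1).
have hs : has (fun l => l.1 == c.1) w.
  have : c \in proj c.1 c.1 w by rewrite E inE eqxx.
  by rewrite mem_filter => /andP[_ cw]; apply/hasP; exists c.
have {hs} [s1 [z [s2 [Ew Ez nh]]]] : exists s1 (z : letter T) s2,
    [/\ w = s1 ++ z :: s2, z.1 = c.1 & ~~ has (fun l => l.1 == c.1) s1].
  by case/split_find: hs => z s1 s2 /eqP Ez nh; exists s1, z, s2; rewrite -cats1 -catA.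
have Es1 : proj c.1 c.1 s1 = [::].
  apply/eqP; rewrite -size_eq0 size_filter -leqn0 leqNgt -has_count.
  by apply: contra nh; apply: sub_has => l; rewrite orbb.
have zc : z = c by move: E; rewrite Ew proj_cat Es1 /proj /= Ez eqxx /= => -[].
exists s1, s2; rewrite -zc; split=> //; rewrite zc.
apply/allP => m ms; apply/negP => /H[r']; rewrite Ew proj_cat.
case E1: (proj c.1 m.1 s1) => [|k s].
  have : m \in proj c.1 m.1 s1 by rewrite mem_filter eqxx orbT.
  by rewrite E1.
case=> kc _; have : k \in proj c.1 m.1 s1 by rewrite E1 inE eqxx.
rewrite mem_filter kc => /andP[_ cs]; case/negP: nh; apply/hasP.
by exists c.
Qed.

(** * Letters that commutations can bring to the front *)

Lemma teq_consl_inv c w w' : teq (c :: w) w' ->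
  exists u v, w' = u ++ c :: v /\ all (indep c) u.
Proof.
move=> H; apply: proj_head_split => x /H <-; exists (proj c.1 x w).
by rewrite /proj /= eqxx.
Qed.

(** Decides whether commutations can bring [c] to the head of [w]. As [c] is not independent of
    itself, only its first occurrence can qualify, and that is the one [rem c] deletes. *)
Fixpoint front c w :=
  if w is m :: w' then (m == c) || indep c m && front c w' else false.

Lemma indep_irr c : indep c c = false.
Proof. by rewrite /indep dep_refl. Qed.

Lemma front_cat c u v : all (indep c) u -> front c (u ++ c :: v).
Proof.
elim: u => [|m u IH] /=; first by rewrite eqxx.
by case/andP=> -> /IH ->; rewrite orbT.
Qed.

Lemma rem_cat c u v : all (indep c) u -> rem c (u ++ c :: v) = u ++ v.
Proof.
elim: u => [|m u IH] /=; first by rewrite eqxx.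
case/andP=> icm /IH ->; case: eqP icm => // ->; by rewrite indep_irr.
Qed.

Lemma frontP c w : front c w -> exists u v, w = u ++ c :: v /\ all (indep c) u.
Proof.
elim: w => //= m w IH /orP[/eqP->|/andP[icm /IH[u [v [-> iu]]]]].
  by exists [::], w.
by exists (m :: u), v; rewrite /= icm.
Qed.

Lemma front_teq c w : front c w -> teq w (c :: rem c w).
Proof.
by move/frontP => [u [v [-> iu]]]; rewrite rem_cat //; exact: teq_move.
Qed.

Lemma teq_front c w w' : teq w (c :: w') -> front c w /\ teq (rem c w) w'.
Proof.
move=> H; have [u [v [E iu]]] := teq_consl_inv (teq_sym H).
rewrite E front_cat // rem_cat //; split=> //; apply: (@teq_cancel [:: c]).
by apply: teq_trans H; rewrite E; apply: teq_sym; exact: teq_move.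
Qed.

Lemma teq_cons_neq c m w w' : teq (c :: w) (m :: w') -> c != m ->
  indep c m /\ exists r, teq w (m :: r) /\ teq w' (c :: r).
Proof.
move=> H ncm; have [] := teq_front H.
rewrite /= (negPf ncm) /= => /andP[icm fm] Hr; split; first by rewrite indep_sym.
by exists (rem m w); split; [exact: front_teq | exact: teq_sym].
Qed.

(** * Normal forms for the group *)

Definition linv l : letter T := (l.1, ~~ l.2).
Lemma linvK : involutive linv. Proof. by case=> x b; rewrite /linv negbK. Qed.

(* Left multiplication of a reduced trace by a letter.  Defining relations of the
   group act trivially up to [teq], which gives the normal form theorem. *)
Definition act l w := if front (linv l) w then rem (linv l) w else l :: w.
Definition irr w := forall u c v, ~ teq w (u ++ c :: linv c :: v).
Definition nf w := foldr act [::] w.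

Lemma act_front l w w' : teq w (linv l :: w') -> teq (act l w) w'.
Proof. by move/teq_front=> [f H]; rewrite /act f. Qed.

Lemma act_nofront l w : ~ (exists w', teq w (linv l :: w')) -> act l w = l :: w.
Proof.
move=> H; rewrite /act; case: ifP => // f; case: H.
by exists (rem (linv l) w); exact: front_teq.
Qed.

Lemma act_teq l w w' : teq w w' -> teq (act l w) (act l w').
Proof.
move=> H; case: (classic (exists r, teq w' (linv l :: r))) => [[r Hr]|H'].
  apply: (teq_trans (act_front (teq_trans H Hr))).
  by apply: teq_sym; exact: act_front.
rewrite (act_nofront H') act_nofront; first exact: teq_cons.
by case=> r Hr; apply: H'; exists r; apply: teq_trans Hr; exact: teq_sym.
Qed.

Lemma irr_teq u v : teq u v -> irr u -> irr v.
Proof. by move=> H iu a c b Hv; apply: (iu a c b); exact: teq_trans Hv. Qed.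

Lemma irr_consr c w : irr (c :: w) -> irr w.
Proof. by move=> iw u l v H; apply: (iw (c :: u) l v); exact: teq_cons. Qed.

Lemma indep_linv l m : indep (linv l) m = indep l m.
Proof. by []. Qed.

Lemma indep_neq l m : indep l m -> l != m.
Proof. by apply: contraTneq => ->; rewrite indep_irr. Qed.

(** Induction on the part [u] before a supposed pair [c], [linv c]. For empty [u], either [l] is [c]
    and its inverse heads [w], or [l] moves past both letters and the pair already lies in [w]. *)
Lemma irr_cons l w : irr w -> ~ (exists w', teq w (linv l :: w')) -> irr (l :: w).
Proof.
move=> iw H u c v; elim: u w iw H => [|k u IH] w iw H /= Hw.
  have [E|nlc] := eqVneq l c.
    by apply: H; exists v; subst c; exact: (@teq_cancel [:: l]).
  have [ilc [r [Hw1 Hr]]] := teq_cons_neq Hw nlc.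
  have nlc' : linv c != l by rewrite indep_neq // indep_linv indep_sym.
  have [_ [s [Hs1 Hs2]]] := teq_cons_neq Hr nlc'.
  by apply: (iw [::] c s); apply: (teq_trans Hw1); exact: teq_cons.
have [E|nlk] := eqVneq l k.
  by apply: (iw u c v); subst k; exact: (@teq_cancel [:: l]).
have [ilk [r [Hw1 Hr]]] := teq_cons_neq Hw nlk.
apply: (IH r) (teq_sym Hr); first by apply: (@irr_consr k); exact: irr_teq iw.
case=> s Hs; apply: H; exists (k :: s); apply: (teq_trans Hw1).
apply: teq_trans (teq_cons k Hs) _; apply: teq_swap.
by rewrite indep_sym indep_linv.
Qed.

Lemma irr_act l w : irr w -> irr (act l w).
Proof.
move=> iw; case: (classic (exists r, teq w (linv l :: r))) => [[r Hr]|H].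
  apply: irr_teq (teq_sym (act_front Hr)) _.
  by apply: (@irr_consr (linv l)); exact: irr_teq iw.
by rewrite act_nofront //; exact: irr_cons.
Qed.

(** Irreducibility enters when the inner action deletes [l]: the rest cannot start with [linv l], so
    the outer action puts [l] back. *)
Lemma actK l w : irr w -> teq (act l (act (linv l) w)) w.
Proof.
move=> iw; case: (classic (exists r, teq w (l :: r))) => [[r Hr]|H].
  have Hr' : teq (act (linv l) w) r by apply: act_front; rewrite linvK.
  apply: (teq_trans (act_teq l Hr')); rewrite act_nofront; first exact: teq_sym.
  by case=> s Hs; apply: (iw [::] l s); apply: (teq_trans Hr); exact: teq_cons.
by rewrite (@act_nofront (linv l)) ?linvK //; exact: act_front.
Qed.

Lemma actC l m w : indep l m -> teq (act l (act m w)) (act m (act l w)).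
Proof.
move=> ilm.
wlog suff main : l m ilm / (exists r, teq w (linv m :: r)) ->
   teq (act l (act m w)) (act m (act l w)).
  case: (classic (exists r, teq w (linv m :: r))) => [|Hm]; first exact: main.
  case: (classic (exists r, teq w (linv l :: r))) => [|Hl].
    by move=> H; apply: teq_sym; apply: main H; rewrite indep_sym.
  have nof (a b : letter T) : indep a b -> ~ (exists r, teq w (linv a :: r)) ->
      act a (b :: w) = a :: b :: w.
    move=> iab na; rewrite act_nofront // => -[r Hr].
    have nba : b != linv a by rewrite indep_neq // indep_sym.
    by have [_ [s [Hs _]]] := teq_cons_neq Hr nba; apply: na; exists s.
  rewrite (act_nofront Hm) (act_nofront Hl) !nof //; last by rewrite indep_sym.
  exact: teq_swap.
case=> r Hr; have Hm := act_front Hr; apply: (teq_trans (act_teq l Hm)).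
case: (classic (exists s, teq w (linv l :: s))) => [[s Hs]|Hl].
  apply: teq_trans (teq_sym (act_teq m (act_front Hs))).
  have nml : linv m != linv l by rewrite indep_neq // indep_sym.
  have [_ [t [Ht1 Ht2]]] := teq_cons_neq (teq_trans (teq_sym Hr) Hs) nml.
  by apply: (teq_trans (act_front Ht1)); apply: teq_sym; exact: act_front.
rewrite (act_nofront Hl) act_nofront; last first.
  case=> s Hs; apply: Hl; exists (linv m :: s); apply: (teq_trans Hr).
  by apply: teq_trans (teq_cons _ Hs) _; apply: teq_swap; rewrite indep_sym.
apply: teq_sym; apply: act_front; apply: teq_trans (teq_cons l Hr) _.
exact: teq_swap.
Qed.

Lemma irr_nf w : irr (nf w).
Proof.
elim: w => [|l w IH] /=; last exact: irr_act.
by move=> u c v /size_teq; rewrite size_cat /= addnS.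
Qed.

Lemma nf_cat u v : nf (u ++ v) = foldr act (nf v) u.
Proof. exact: foldr_cat. Qed.

Lemma foldr_act_teq u v v' : teq v v' -> teq (foldr act v u) (foldr act v' u).
Proof. by move=> H; elim: u => //= l u IH; exact: act_teq. Qed.

Lemma nf_step u v : step e u v -> teq (nf u) (nf v).
Proof.
case=> [a b x i|a b p q npq]; rewrite !nf_cat; apply: foldr_act_teq => /=.
  exact (actK (x, i) (@irr_nf b)).
(* A swap may involve two letters on the same generator: equal letters change nothing, inverse ones
   cancel in both orders. *)
have [Epq|npq1] := eqVneq p.1 q.1; last by apply: actC; rewrite /indep negb_or npq1.
have [->|npq2] := eqVneq p q; first exact: teq_refl.
have -> : q = linv p.
  by case: p q Epq npq2 {npq} => [x i] [y j] /= ->; case: i; case: j; rewrite ?eqxx.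
apply: (teq_trans (actK _ (@irr_nf b))); apply: teq_sym.
by rewrite -{2}[p]linvK; apply: actK; exact: irr_nf.
Qed.

Lemma nf_weq u v : weq e u v -> teq (nf u) (nf v).
Proof.
elim=> {u v} [u v /nf_step //|//|u v _ /teq_sym //|u v w _ H1 _ H2].
exact: teq_trans H1 H2.
Qed.

Lemma size_act l w : size (act l w) <= (size w).+1.
Proof.
rewrite /act; case: ifP => //= /frontP[u [v [-> iu]]].
by rewrite rem_cat // !size_cat /= addnS !leqW.
Qed.

Lemma size_nf w : size (nf w) <= size w.
Proof. by elim: w => //= l w IH; exact: leq_trans (size_act _ _) _. Qed.

Lemma nf_id w : size (nf w) = size w -> nf w = w.
Proof.
elim: w => //= l w IH; rewrite /act; case: ifP => [|_] /=; last by case=> /IH ->.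
case/frontP=> u [v [E iu]]; have := size_nf w; rewrite E rem_cat // !size_cat /= addnS.
by move=> H1 H2; move: H1; rewrite H2 ltnNge leqnSn.
Qed.

(** * Equality in the group: congruence, inverses, conjugation, powers *)

Lemma weq_refl w : weq e w w. Proof. exact: rst_refl. Qed.
Lemma weq_sym u v : weq e u v -> weq e v u. Proof. exact: rst_sym. Qed.
Lemma weq_trans v u w : weq e u v -> weq e v w -> weq e u w.
Proof. exact: rst_trans. Qed.

Lemma weq_ctx a b u v : weq e u v -> weq e (a ++ u ++ b) (a ++ v ++ b).
Proof.
elim=> {u v} [u v H|u|u v _|u v w _ H1 _ H2].
- case: H => [s t x i|s t p q npq]; apply: rst_step; rewrite -!catA (catA a).
    by rewrite (catA a s (t ++ b)); exact: st_cancel.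
  by rewrite (catA a s [:: q, p & _]); exact: st_swap.
- exact: weq_refl.
- exact: weq_sym.
- exact: weq_trans H1 H2.
Qed.

Lemma weq_cat u u' v v' : weq e u u' -> weq e v v' -> weq e (u ++ v) (u' ++ v').
Proof.
move=> H1 H2; apply: (@weq_trans (u' ++ v)); first exact: (@weq_ctx [::] v).
by have := @weq_ctx u' [::] _ _ H2; rewrite !cats0.
Qed.

Lemma weq_cancel c v : weq e (c :: linv c :: v) v.
Proof. by case: c => x b; apply: rst_step; exact: (@st_cancel _ e [::]). Qed.

Lemma weq_move c u v : all (indep c) u -> weq e (u ++ c :: v) (c :: u ++ v).
Proof.
elim: u => [|m u IH] /=; first by move=> _; exact: weq_refl.
case/andP=> icm /IH H; apply: (@weq_trans (m :: c :: u ++ v)).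
  exact: (@weq_cat [:: m] [:: m]) (weq_refl _) H.
apply: rst_step; apply: (@st_swap _ e [::]); move: icm; rewrite indep_sym.
by rewrite /indep negb_or => /andP[].
Qed.

Lemma weq_teq u v : teq u v -> weq e u v.
Proof.
elim: u v => [|c u IH] v H.
  by have /esym/size0nil -> := size_teq H; exact: weq_refl.
have [a [b [E ia]]] := teq_consl_inv H; rewrite E.
apply: weq_trans (weq_sym (weq_move b ia)).
apply: (@weq_cat [:: c] [:: c]); [exact: weq_refl | apply: IH].
apply: (@teq_cancel [:: c]); apply: (teq_trans H); rewrite E; exact: teq_move.
Qed.

Lemma winv_cons c w : winv (c :: w) = winv w ++ [:: linv c].
Proof. by rewrite /winv /= rev_cons cats1. Qed.

Lemma winvK : involutive (@winv T).
Proof.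
move=> w; rewrite /winv map_rev revK -map_comp map_id_in // => -[x b] _ /=.
by rewrite negbK.
Qed.

Lemma weq_mulV w : weq e (w ++ winv w) [::].
Proof.
elim: w => [|c w IH]; first exact: weq_refl.
have -> : (c :: w) ++ winv (c :: w) = [:: c] ++ (w ++ winv w) ++ [:: linv c].
  by rewrite winv_cons /= catA.
apply: (@weq_trans [:: c; linv c]); last exact: weq_cancel.
exact: (weq_ctx [:: c] [:: linv c] IH).
Qed.

Lemma weq_Vmul w : weq e (winv w ++ w) [::].
Proof. by rewrite -{2}[w]winvK; exact: weq_mulV. Qed.

Lemma weq_conjP (x z y : word T) : weq e (x ++ z) (z ++ y) -> weq e x (z ++ y ++ winv z).
Proof.
move=> H; rewrite catA; apply: weq_trans (weq_cat H (weq_refl _)).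
rewrite -catA; apply: weq_sym; rewrite -{2}[x]cats0.
exact: weq_cat (weq_refl _) (weq_mulV _).
Qed.

Lemma weq_conj_cat (z y : word T) : weq e ((z ++ y ++ winv z) ++ z) (z ++ y).
Proof.
rewrite -!catA -[X in weq e _ (z ++ X)]cats0.
do 2 apply: weq_cat (weq_refl _) _; exact: weq_Vmul.
Qed.

Lemma wpow_add w i j : wpow w (i + j) = wpow w i ++ wpow w j.
Proof. by elim: i => //= i ->; rewrite catA. Qed.

Lemma wpowSr w n : wpow w n.+1 = wpow w n ++ w.
Proof. by rewrite -addn1 wpow_add /= cats0. Qed.

Lemma weq_wpow u v n : weq e u v -> weq e (wpow u n) (wpow v n).
Proof. by move=> H; elim: n => [|n IH] /=; [exact: weq_refl | exact: weq_cat]. Qed.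

Lemma wpow_comm (x z y : word T) n : weq e (x ++ z) (z ++ y) ->
  weq e (wpow x n ++ z) (z ++ wpow y n).
Proof.
move=> H; elim: n => [|n IH]; first by rewrite /= cats0; exact: weq_refl.
rewrite [wpow x _]/= -catA; apply: (weq_trans (weq_cat (weq_refl x) IH)).
by rewrite catA /= [z ++ y ++ _]catA; exact: weq_cat H (weq_refl _).
Qed.

(** Conjugating back by [z] makes [g] an [i]-th power; [i = 0] would make it trivial, and [i >= 2]
    contradicts primitivity. *)
Lemma primitive_conj (g z g' t : word T) i : primitive e g -> weq e (g ++ z) (z ++ g') ->
  weq e g' (wpow t i) -> i = 1.
Proof.
move=> [g1 pg] H Ht; have {}H := weq_trans H (weq_cat (weq_refl z) Ht).
have E : weq e g (wpow (z ++ t ++ winv z) i).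
  apply: weq_trans (weq_conjP H) _; apply: weq_sym; apply: weq_conjP.
  by apply: wpow_comm; exact: weq_conj_cat.
case: i E {H Ht} => [|[|i]] // E.
by case: (pg _ i.+2 isT E).
Qed.

(** * Length, reduced words and support *)

Lemma pbP (P : Prop) : reflect P (pb P).
Proof. by rewrite /pb; case: excluded_middle_informative => H; constructor. Qed.

Lemma wlen_min w w' : weq e w w' -> wlen e w <= size w'.
Proof.
move=> H; rewrite /wlen; case: ex_minnP => m _; apply; apply/pbP; by exists w'.
Qed.

Lemma wlen_rep w : exists2 w', weq e w w' & size w' = wlen e w.
Proof.
by rewrite /wlen; case: ex_minnP => m /pbP[w' [H1 H2]] _; exists w'.
Qed.

Lemma wlen_weq u v : weq e u v -> wlen e u = wlen e v.
Proof.
move=> H; apply/eqP; rewrite eqn_leq; apply/andP; split.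
  by have [w Hw <-] := wlen_rep v; apply: wlen_min; exact: weq_trans Hw.
have [w Hw <-] := wlen_rep u; apply: wlen_min; apply: weq_trans Hw.
exact: weq_sym.
Qed.

Lemma weq_act l w : weq e (l :: w) (act l w).
Proof.
rewrite /act; case: ifP => [/front_teq/weq_teq H|_]; last exact: weq_refl.
apply: weq_trans (weq_cancel l _).
exact: (@weq_cat [:: l] [:: l]) (weq_refl _) H.
Qed.

Lemma weq_nf w : weq e w (nf w).
Proof.
elim: w => [|l w IH] /=; first exact: weq_refl.
apply: weq_trans (weq_act l _); exact: (@weq_cat [:: l] [:: l]) (weq_refl _) IH.
Qed.

Lemma reduced_nf w : reduced e w -> nf w = w.
Proof.
move=> rw; apply: nf_id; apply/eqP; rewrite eqn_leq size_nf rw.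
exact: wlen_min (weq_nf w).
Qed.

(** A reduced word is its own normal form, and normal forms of equal elements are equal traces. *)
Lemma reduced_teq u v : reduced e u -> reduced e v -> weq e u v -> teq u v.
Proof. by move=> /reduced_nf Eu /reduced_nf Ev /nf_weq; rewrite Eu Ev. Qed.

Lemma cnt_gt0 x w : (0 < cnt x w) = (x \in map fst w).
Proof.
rewrite -has_count; apply/hasP/mapP => [[l lw /eqP E]|[l lw E]]; exists l => //.
by rewrite E.
Qed.

Lemma supp_reduced w w' x : weq e w w' -> reduced e w' -> supp e w x = (0 < cnt x w').
Proof.
move=> H rw; rewrite cnt_gt0; apply/pbP/idP => [[v [Hv [rv]]]|]; last by exists w'.
rewrite -!cnt_gt0 (@cnt_teq _ v w') //; apply: reduced_teq => //.
by apply: weq_trans H; exact: weq_sym.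
Qed.

Lemma supp_letter l x : supp e [:: l] x -> x = l.1.
Proof.
case/pbP=> w [/nf_weq H [/reduced_nf E]]; rewrite E in H.
by rewrite -cnt_gt0 -(cnt_teq _ H) cnt_gt0 /= inE => /eqP.
Qed.

(** * Prefixes and periods of words *)

Lemma prefix_comparable (s t w : word T) :
  prefix s w -> prefix t w -> size s <= size t -> prefix s t.
Proof.
rewrite !prefixE => /eqP Es /eqP Et le; rewrite -{1}Et take_takel //.
by rewrite Es.
Qed.

Lemma prefix_cat2 (s t w : word T) : prefix (s ++ t) (s ++ w) = prefix t w.
Proof. by elim: s => //= l s IH; rewrite eqxx. Qed.

Lemma size_wpow w n : size (wpow w n) = n * size w.
Proof. by elim: n => //= n IH; rewrite size_cat IH mulSn. Qed.

Lemma proj_wpow x y w n : proj x y (wpow w n) = wpow (proj x y w) n.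
Proof. by elim: n => //= n <-; rewrite proj_cat. Qed.

Lemma cnt_wpow x w n : cnt x (wpow w n) = n * cnt x w.
Proof. by elim: n => //= n IH; rewrite cnt_cat IH mulSn. Qed.

(** Periodicity is expressed as agreement of [s] with its shift by [g]; both words are prefixes of
    the next power of [g]. *)
Lemma prefix_wpow_shift (s g : word T) n : prefix s (wpow g n) -> prefix s (g ++ s).
Proof.
move=> H; apply: (@prefix_comparable _ _ (wpow g n.+1)).
- by rewrite wpowSr; exact: prefix_catl.
- by rewrite /= prefix_cat2.
- by rewrite size_cat leq_addl.
Qed.

(** A weak form of the Fine-Wilf theorem: [w] is long enough to have both [g1 ++ g2] and [g2 ++ g1]
    as prefixes, and these have the same length. *)
Lemma periods_commute (g1 g2 w : word T) :
  prefix w (g1 ++ w) -> prefix w (g2 ++ w) -> size g1 + size g2 <= size w ->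
  g1 ++ g2 = g2 ++ g1.
Proof.
have pre (g g' : word T) : prefix w (g ++ w) -> prefix w (g' ++ w) ->
    size g + size g' <= size w -> prefix (g ++ g') w.
  move=> H H' le.
  have pg : prefix g w.
    apply: (prefix_comparable _ H); first exact: prefix_prefix.
    by apply: leq_trans le; exact: leq_addr.
  have pg' : prefix g' w.
    apply: (prefix_comparable _ H'); first exact: prefix_prefix.
    by apply: leq_trans le; exact: leq_addl.
  case/prefixP: pg => w1 E; rewrite E prefix_cat2; move: H; rewrite E prefix_cat2 -E => H.
  apply: prefix_comparable pg' H _; move: le; rewrite E size_cat.
  by rewrite leq_add2l.
move=> H1 H2 le; have p12 := pre _ _ H1 H2 le.
have p21 := pre _ _ H2 H1; rewrite addnC in p21; have {}p21 := p21 le.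
have := prefix_comparable p12 p21; rewrite !size_cat addnC leqnn prefixE => /(_ isT).
by rewrite take_oversize ?size_cat 1?addnC // => /eqP.
Qed.

Lemma cnt_projr x y w : cnt x (proj x y w) = cnt x w.
Proof.
rewrite /cnt count_filter; apply: eq_count => l /=; by case: eqP.
Qed.

Lemma cnt_prefix x s t : prefix s t -> cnt x s <= cnt x t.
Proof. by case/prefixP=> r ->; rewrite cnt_cat leq_addr. Qed.

(** The powers [wpow s (size t)] and [wpow t (size s)] commute and have the same length, hence
    coincide. *)
Lemma cnt_commute x (s t : word T) : s ++ t = t ++ s -> size t * cnt x s = size s * cnt x t.
Proof.
move=> E; have E1 i : wpow s i ++ t = t ++ wpow s i.
  elim: i => [|i IH] /=; first by rewrite cats0.
  by rewrite -catA IH !catA E.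
have E2 i j : wpow s i ++ wpow t j = wpow t j ++ wpow s i.
  elim: j => [|j IH] /=; first by rewrite cats0.
  by rewrite catA E1 -!catA IH.
have /eqP := E2 (size t) (size s).
rewrite eqseq_cat; last by rewrite !size_wpow mulnC.
case/andP=> /eqP H _.
by rewrite -cnt_wpow H cnt_wpow.
Qed.

(** * Divisibility, joins, common roots and shifted periods of traces *)

Lemma teq_prefix v u : (forall x y, dep x y -> prefix (proj x y v) (proj x y u)) ->
  exists r, teq u (v ++ r).
Proof.
elim: v u => [|c v IH] u H; first by exists u.
have [|s [t [E iu]]] := @proj_head_split c u.
  move=> x d; have := H _ _ d; rewrite {1}/proj /= eqxx /=.
  by case: (proj c.1 x u) => // l r /andP[/eqP -> _]; exists r.
have Hu : teq u (c :: s ++ t) by rewrite E; exact: teq_move.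
have [|r Hr] := IH (s ++ t); last by exists r; apply: teq_trans Hu _; exact: teq_cons.
move=> x y d; have := H _ _ d; rewrite (Hu _ _ d) -(cat1s c v) -(cat1s c (s ++ t)).
by rewrite (proj_cat x y [:: c] v) (proj_cat x y [:: c] (s ++ t)) prefix_cat2.
Qed.

Lemma front_catE c u v : front c (u ++ v) -> front c u || all (indep c) u && front c v.
Proof.
elim: u => //= m u IH /orP[->//|/andP[-> /IH /orP[->|->]]]; by rewrite /= ?orbT.
Qed.

(* [a ++ t] is the least common upper bound of the prefixes [a] and [b]. *)
Lemma teq_join a b r s : teq (a ++ r) (b ++ s) ->
  exists t s', teq (a ++ t) (b ++ s') /\
    forall x y, dep x y -> proj x y t = [::] \/ proj x y s' = [::].
Proof.
elim: a b r s => [|c a IH] b r s /= H.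
  by exists b, [::]; rewrite cats0; split => //; right.
(* Either [c] can be taken from [b] and is shared, or it is independent of all of [b] and joins the
   complement [s']. *)
have [/front_catE/orP[fb|/andP[ib fs]] _] := teq_front (teq_sym H).
  have Hb := front_teq fb; have [|t [s' [H1 H2]]] := IH (rem c b) r s.
    apply: (@teq_cancel [:: c]); apply: (teq_trans H).
    exact: (teq_cat Hb (@teq_refl s)).
  exists t, s'; split=> //; apply: (teq_trans (teq_cons c H1)).
  exact: teq_sym (teq_cat Hb (@teq_refl s')).
have Hs := front_teq fs; have [|t [s' [H1 H2]]] := IH b r (rem c s).
  apply: (@teq_cancel [:: c]); apply: (teq_trans H).
  apply: (teq_trans (teq_catl b Hs)); exact: teq_move.
exists t, (c :: s'); split.
  by apply: (teq_trans (teq_cons c H1)); apply: teq_sym; exact: teq_move.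
move=> x y d; case cxy: ((c.1 == x) || (c.1 == y)); last first.
  by rewrite {2}/proj /= cxy; exact: H2.
(* In a projection that sees [c], [b] vanishes, so an empty [s'] forces [a ++ t], hence [t], to be
   empty there. *)
left; have := H1 _ _ d; rewrite !proj_cat (proj_indep d cxy ib) /=.
by case: (H2 _ _ d) => [//|->]; case: (proj x y a) => //=; case: (proj x y t).
Qed.

(** Euclidean algorithm on traces: the shorter [v] divides [u], and the quotient [r] still commutes
    with [v] and keeps proportional counts. *)
Lemma teq_commute u v : teq (u ++ v) (v ++ u) ->
  (forall x y, cnt x u * cnt y v = cnt y u * cnt x v) ->
  exists t i j, teq u (wpow t i) /\ teq v (wpow t j).
Proof.
have [n] := ubnP (size u + size v); elim: n u v => // n IH u v.
wlog le : u v / size v <= size u.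
  move=> W len C Pr; have [le|/ltnW le] := leqP (size v) (size u); first exact: W.
  have [|||t [i [j [H1 H2]]]] := W v u le; last by exists t, j, i.
  - by rewrite addnC.
  - exact: teq_sym.
  - by move=> x y; rewrite mulnC -Pr mulnC.
move=> len C Pr; case: (posnP (size v)) => [/size0nil ->|v0].
  by exists u, 1, 0; split; rewrite //= cats0.
(* Summing the proportionality over [x] gives [size u * cnt y v = cnt y u * size v]. *)
have le_cnt y : cnt y v <= cnt y u.
  rewrite -(leq_pmul2l (leq_trans v0 le)) -{1}sum_cnt big_distrl /=.
  rewrite (eq_bigr (fun x => cnt y u * cnt x v)) // -big_distrr sum_cnt /= mulnC.
  by rewrite leq_mul2r le orbT.
have [|r Hr] := @teq_prefix v u.
  move=> x y d; apply: (@prefix_comparable _ _ (proj x y (v ++ u))).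
  - by rewrite proj_cat prefix_prefix.
  - by rewrite -(C _ _ d) proj_cat prefix_prefix.
  - by rewrite !size_proj; case: ifP => _; rewrite ?addn0 ?leq_add.
have Cr : teq (r ++ v) (v ++ r).
  apply: (@teq_cancel v); rewrite catA; apply: teq_trans (teq_catl v Hr).
  by apply: teq_trans C; exact: teq_cat (teq_sym Hr) (@teq_refl v).
have Er x : cnt x u = cnt x v + cnt x r by rewrite (cnt_teq x Hr) cnt_cat.
have Es : size u = size v + size r by rewrite (size_teq Hr) size_cat.
have [|x y|t [i [j [H1 H2]]]] := IH r v _ Cr.
- by rewrite addnC -Es; move: len; rewrite ltnS; apply: leq_trans; rewrite -addn1 leq_add2l.
- by have := Pr x y; rewrite !Er !mulnDl [cnt y v * _]mulnC => /addnI.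
exists t, (j + i), j; split=> //; apply: (teq_trans Hr); rewrite wpow_add.
exact: teq_cat.
Qed.

(* [w] ranges over the factors of [h] that follow [A] inside the periodic part. *)
Lemma conjugate_period a g n b h A u :
  teq h (a ++ wpow g n ++ b) -> teq A (a ++ u) ->
  (forall x y, dep x y -> prefix (proj x y A) (proj x y h)) ->
  (forall x y, dep x y ->
     size (proj x y A) <= size (proj x y a) + n * size (proj x y g)) ->
  exists g', teq (g ++ u) (u ++ g') /\ forall x y w, dep x y ->
     prefix (proj x y A ++ w) (proj x y h) ->
     size (proj x y A) + size w <= size (proj x y a) + n * size (proj x y g) ->
     prefix w (proj x y g' ++ w).
Proof.
move=> Hh HA pA sA.
have key x y w : dep x y -> prefix (proj x y A ++ w) (proj x y h) ->
     size (proj x y A) + size w <= size (proj x y a) + n * size (proj x y g) ->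
     prefix (proj x y u ++ w) (proj x y g ++ proj x y u ++ w).
  move=> d; rewrite (HA _ _ d) (Hh _ _ d) !proj_cat -catA prefix_cat2 => Hw.
  rewrite size_cat -addnA leq_add2l => sw; apply: (@prefix_wpow_shift _ _ n).
  apply: prefix_comparable Hw _ _; rewrite -?proj_wpow; first exact: prefix_prefix.
  by rewrite proj_wpow size_wpow size_cat.
(* With [w] empty, [key] makes [u] divide [g ++ u]; the quotient [g'] is the conjugate of [g] read
   from the end of [A]. *)
have [|g' Hg] := @teq_prefix u (g ++ u).
  move=> x y d; rewrite proj_cat; have := key x y [::] d; rewrite !cats0 addn0.
  by apply; [exact: pA | exact: sA].
exists g'; split=> // x y w d Hw sw; have := key x y w d Hw sw.
by rewrite catA -proj_cat (Hg _ _ d) proj_cat -catA prefix_cat2.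
Qed.

(** * Offset and overlap of the two periodic parts *)

(* [a1], [a2] and [p] stand for the letter counts of two prefixes and of a period.
   The edge hypotheses say that prefixes of a trace are comparable in each
   projection; walking along the support of [p] costs one period per edge.
   Minimality of [k] for the non-strict inequality makes the last bound strict,
   which is what leaves two full periods in [overlap]. *)
Lemma near_linear (a1 a2 p : T -> nat) n X :
  (forall j s y, j <= n -> e s y -> a2 s < a1 s + j * p s -> a2 y <= a1 y + j * p y) ->
  (forall j s y, j <= n -> e s y -> a1 s + j * p s < a2 s -> a1 y + j * p y <= a2 y) ->
  (forall x y, 0 < p x -> 0 < p y ->
     connect (fun a b => [&& e a b, 0 < p a & 0 < p b]) x y) ->
  (forall y, exists2 s, 0 < p s & dep y s) ->
  0 < \sum_x p x -> \sum_x a1 x <= X -> \sum_x a2 x <= X ->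
  X + #|T| * \sum_x p x <= \sum_x a1 x + n * \sum_x p x ->
  exists k, (forall y, a2 y <= a1 y + k * p y) /\
    \sum_x a1 x + k * \sum_x p x < X + #|T| * \sum_x p x.
Proof.
move=> up dn conn dom; set P := \sum_x p x => P0 le1 le2 leX.
have [z pz] : exists z, 0 < p z.
  have [/existsP//|/existsPn H] := boolP [exists z, 0 < p z].
  by move: P0; rewrite /P big1 // => x _; apply/eqP; rewrite -leqn0 leqNgt H.
have V0 : 0 < #|T| by apply/card_gt0P; exists z.
have edge y s : p y = 0 -> 0 < p s -> dep y s -> e s y.
  by move=> y0 s0 /orP[/eqP E|]; [rewrite E in y0; rewrite y0 in s0 | rewrite e_sym].
(* The aim is the least [k] at which some generator of the support is covered; the disjunct [n <= k]
   ensures that a least [k] exists. *)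
pose Q k := (n <= k) || [exists x, (0 < p x) && (a2 x <= a1 x + k * p x)].
have exQ : exists k, Q k by exists n; rewrite /Q leqnn.
case: (ex_minnP exQ) => m Qm minm {exQ}.
(* For positive [m], minimality puts all counts after one period less below those of [a2], strictly
   so at [z]. *)
have size_m : \sum_x a1 x + m * P < X + P.
  case: m Qm minm => [|m] _ minm; first by rewrite mul0n; lia.
  have /norP[] : ~~ Q m by apply/negP => /minm; rewrite ltnn.
  rewrite -ltnNge => mn /existsPn nQ.
  have lt_supp x : 0 < p x -> a1 x + m * p x < a2 x.
    by move=> px; have := nQ x; rewrite px /= -ltnNge.
  have le_all y : a1 y + m * p y <= a2 y.
    case: (posnP (p y)) => [y0|/lt_supp/ltnW //]; have [s ps d] := dom y.
    by apply: (dn m s); [exact: ltnW | exact: edge | exact: lt_supp].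
  suff : \sum_x a1 x + m * P < \sum_x a2 x by rewrite mulSn; lia.
  rewrite /P big_distrr -big_split /= (bigD1 z) // [X in _ < X](bigD1 z) //=.
  by rewrite -addSn leq_add ?lt_supp ?leq_sum.
(* A simple path in the support has at most [#|T|.-1] edges, each costing one period. *)
pose k := m + #|T|.-1.
have size_k : \sum_x a1 x + k * P < X + #|T| * P.
  by rewrite /k -{2}(prednK V0) mulnDl mulSn; lia.
have kn : k < n.
  by rewrite -(ltn_pmul2r P0); move: (leq_trans size_k leX); rewrite ltn_add2l.
exists k; split=> //.
have /existsP[x /andP[px ax]] : [exists x, (0 < p x) && (a2 x <= a1 x + m * p x)].
  by case/orP: Qm => // nm; move: kn; rewrite ltnNge (leq_trans nm) ?leq_addr.
have walk s x0 j : path (fun a b => [&& e a b, 0 < p a & 0 < p b]) x0 s ->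
    j + size s <= n -> a2 x0 <= a1 x0 + j * p x0 ->
    a2 (last x0 s) <= a1 (last x0 s) + (j + size s) * p (last x0 s).
  elim: s x0 j => [|y s IH] x0 j /=; first by rewrite addn0.
  case/andP=> /and3P[exy px0 py] Hp; rewrite addnS -addSn => jn Hx.
  apply: IH => //; apply: (up j.+1 x0); first by apply: leq_trans jn; rewrite leq_addr.
    by [].
  by rewrite mulSn; lia.
have in_supp y : 0 < p y -> a2 y <= a1 y + k * p y.
  move=> py; case/connectP: (conn _ _ px py) => s0 Hs0 ->; case: (shortenP Hs0) => s Hs us _.
  have ss : size s <= #|T|.-1.
    by rewrite -ltnS prednK // -[(size s).+1]/(size (x :: s)) -(card_uniqP us) max_card.
  have sk : m + size s <= k by rewrite leq_add2l.
  apply: leq_trans (walk _ _ _ Hs (leq_trans sk (ltnW kn)) ax) _.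
  by rewrite leq_add2l leq_mul2r sk orbT.
move=> y; case: (posnP (p y)) => [y0|]; last exact: in_supp.
(* As [p y = 0], any multiple of it may be inserted; taking [k.+1] gives [up] its strict hypothesis
   at [s]. *)
have [s ps d] := dom y; rewrite y0 muln0 -(muln0 k.+1) -y0.
apply: (up _ s) => //; first exact: edge.
by rewrite mulSn; have := in_supp s ps; lia.
Qed.

(** The projections of [u] and [v] to [s] and [y] are prefixes of one word, and the count of [s]
    tells which is shorter. *)
Lemma cnt_comparable u u' v v' s y : teq (u ++ u') (v ++ v') -> e s y ->
  cnt s u < cnt s v -> cnt y u <= cnt y v.
Proof.
move=> H esy lt; have d : dep s y by rewrite /dep esy orbT.
have E := H _ _ d; rewrite !proj_cat in E.
have pu : prefix (proj s y u) (proj s y v ++ proj s y v') by rewrite -E prefix_prefix.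
have pv : prefix (proj s y v) (proj s y v ++ proj s y v') by exact: prefix_prefix.
case: (leqP (size (proj s y u)) (size (proj s y v))) => [le|/ltnW le].
  by have := cnt_prefix y (prefix_comparable pu pv le); rewrite !(projC s) !cnt_projr.
have := cnt_prefix s (prefix_comparable pv pu le); rewrite !cnt_projr.
by rewrite leqNgt lt.
Qed.

(** The form in which [strongly_non_split] is used, for a reduced representative. Since [dep]
    includes equality, generators of the support dominate themselves. *)
Definition connected_dominating g :=
  (forall x y, 0 < cnt x g -> 0 < cnt y g ->
     connect (fun a b => [&& e a b, 0 < cnt a g & 0 < cnt b g]) x y) /\
  (forall y, exists2 s, 0 < cnt s g & dep y s).

Lemma leq_size_proj u v w k : (forall x, cnt x u <= cnt x v + k * cnt x w) ->
  forall x y, size (proj x y u) <= size (proj x y v) + k * size (proj x y w).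
Proof.
move=> H x y; have := H x; have := H y; rewrite !size_proj.
by case: ifP => _; rewrite ?addn0 // mulnDr; lia.
Qed.

(** [near_linear] is applied once to prefixes and once to suffixes. The sum of the two offsets stays
    at least two below [n], and these two periods survive in every projection. *)
Lemma overlap (a1 g b1 a2 m b2 : word T) n :
  teq (a1 ++ wpow g n ++ b1) (a2 ++ m ++ b2) -> connected_dominating g -> 0 < size g ->
  maxn (size a1) (size a2) + maxn (size b1) (size b2) + (2 * #|T| + 1) * size g
    <= size (a1 ++ wpow g n ++ b1) ->
  forall x y, maxn (size (proj x y a1)) (size (proj x y a2))
     + maxn (size (proj x y b1)) (size (proj x y b2)) + 2 * size (proj x y g)
     <= size (proj x y (a1 ++ wpow g n ++ b1)).
Proof.
move=> Hh [conn dom] g0; rewrite !size_cat size_wpow mulnDl mul1n -mulnA => Hsz.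
have Hcnt x : cnt x a1 + (n * cnt x g + cnt x b1) = cnt x a2 + (cnt x m + cnt x b2).
  by rewrite -cnt_wpow -!cnt_cat (cnt_teq x Hh).
have cmp j s y : j <= n -> e s y ->
    (cnt s a2 < cnt s a1 + j * cnt s g -> cnt y a2 <= cnt y a1 + j * cnt y g) /\
    (cnt s a1 + j * cnt s g < cnt s a2 -> cnt y a1 + j * cnt y g <= cnt y a2).
  move=> jn esy; have Hj : teq ((a1 ++ wpow g j) ++ wpow g (n - j) ++ b1) (a2 ++ m ++ b2).
    by rewrite -catA (catA (wpow g j)) -wpow_add subnKC.
  rewrite -!cnt_wpow -!cnt_cat; split; apply: cnt_comparable => //; last exact: Hj.
  exact: teq_sym Hj.
(* Suffixes are compared through their complementary prefixes, as the total counts agree by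
   [Hcnt]. *)
have cmp' j s y : j <= n -> e s y ->
    (cnt s b2 < cnt s b1 + j * cnt s g -> cnt y b2 <= cnt y b1 + j * cnt y g) /\
    (cnt s b1 + j * cnt s g < cnt s b2 -> cnt y b1 + j * cnt y g <= cnt y b2).
  move=> jn esy; have Hj : teq ((a1 ++ wpow g (n - j)) ++ wpow g j ++ b1) ((a2 ++ m) ++ b2).
    by rewrite -!catA (catA (wpow g (n - j))) -wpow_add subnK.
  have En x : n * cnt x g = (n - j) * cnt x g + j * cnt x g by rewrite -mulnDl subnK.
  have C1 := cnt_comparable Hj esy; have C2 := cnt_comparable (teq_sym Hj) esy.
  rewrite !cnt_cat !cnt_wpow in C1 C2.
  have := Hcnt s; have := Hcnt y; rewrite !En; by split; lia.
have P0 : 0 < \sum_x cnt x g by rewrite sum_cnt.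
have [|||||k [Hk sk]] := @near_linear (cnt^~ a1) (cnt^~ a2) (cnt^~ g) n
    (maxn (size a1) (size a2)) _ _ conn dom P0; rewrite ?sum_cnt ?leq_maxl ?leq_maxr //.
- by move=> j s y jn es; case: (cmp j s y jn es).
- by move=> j s y jn es; case: (cmp j s y jn es).
- have := leq_maxl (size b1) (size b2); lia.
have [|||||k' [Hk' sk']] := @near_linear (cnt^~ b1) (cnt^~ b2) (cnt^~ g) n
    (maxn (size b1) (size b2)) _ _ conn dom P0; rewrite ?sum_cnt ?leq_maxl ?leq_maxr //.
- by move=> j s y jn es; case: (cmp' j s y jn es).
- by move=> j s y jn es; case: (cmp' j s y jn es).
- have := leq_maxl (size a1) (size a2); lia.
move: sk sk'; rewrite !sum_cnt => sk sk'.
(* The strict bounds [sk] and [sk'], added to the size hypothesis, give [k + k' + 1 < n]. *)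
have kn : k + k' + 2 <= n.
  suff : (k + k' + 1) * size g < n * size g by rewrite ltn_pmul2r //; lia.
  by rewrite !mulnDl mul1n; lia.
move=> x y; have := leq_size_proj Hk x y; have := leq_size_proj Hk' x y.
rewrite !proj_cat proj_wpow !size_cat size_wpow.
have : (k + k' + 2) * size (proj x y g) <= n * size (proj x y g) by rewrite leq_mul2r kn orbT.
rewrite !mulnDl; lia.
Qed.

(** * Conjugacy of the two quasi-roots *)

Lemma proportional_cnt u v : teq (u ++ v) (v ++ u) -> connected_dominating u ->
  (forall x, (0 < cnt x u) = (0 < cnt x v)) ->
  forall x y, cnt x u * cnt y v = cnt y u * cnt x v.
Proof.
move=> C [conn _] Esupp x y.
have zero z : 0 < cnt z u \/ cnt z u = 0 /\ cnt z v = 0.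
  case: (posnP (cnt z u)) => [z0|]; [right | by left]; split=> //.
  by apply/eqP; rewrite -leqn0 leqNgt -Esupp z0.
case: (zero x) => [px|[-> ->]]; last by rewrite muln0.
case: (zero y) => [py|[-> ->]]; last by rewrite muln0.
(* On an edge the projections commute as words, so [cnt_commute] applies; the product of the two
   counts of [w] cancels. *)
have step_edge (w z : T) : e w z -> cnt w u * cnt z v = cnt z u * cnt w v.
  move=> ewz; have [->//|nwz] := eqVneq w z.
  have d : dep w z by rewrite /dep ewz orbT.
  have E := C _ _ d; rewrite !proj_cat in E.
  have := cnt_commute w E; rewrite !cnt_projr !size_proj (negPf nwz).
  by rewrite mulnDl mulnDl; lia.
case/connectP: (conn _ _ px py) => s Hs ->.
suff walk (w : T) : path (fun a b => [&& e a b, 0 < cnt a u & 0 < cnt b u]) w s ->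
    cnt x u * cnt w v = cnt w u * cnt x v ->
    cnt x u * cnt (last w s) v = cnt (last w s) u * cnt x v by exact: walk Hs _.
elim: s w {Hs} => [|z s IH] w //= /andP[/and3P[ewz pw pz] Hs] Hw; apply: IH Hs _.
apply/eqP; rewrite -(eqn_pmul2l pw); apply/eqP.
by rewrite mulnCA step_edge // mulnCA Hw mulnCA.
Qed.
Lemma quasi_roots_conjugate (a1 g1 b1 a2 g2 b2 : word T) n1 n2 :
  teq (a1 ++ wpow g1 n1 ++ b1) (a2 ++ wpow g2 n2 ++ b2) ->
  connected_dominating g1 -> connected_dominating g2 ->
  (forall g, g \in [:: g1; g2] ->
    maxn (size a1) (size a2) + maxn (size b1) (size b2) + (2 * #|T| + 1) * size g
    <= size (a1 ++ wpow g1 n1 ++ b1)) ->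
  primitive e g1 -> primitive e g2 ->
  weq e (a1 ++ g1 ++ winv a1) (a2 ++ g2 ++ winv a2).
Proof.
set h := a1 ++ _ => Hh cd1 cd2 Hsz pr1 pr2.
have size_gt0 g : primitive e g -> 0 < size g.
  by case: g => // -[[]]; exact: weq_refl.
have ov1 := overlap Hh cd1 (size_gt0 _ pr1) (Hsz g1 (mem_head _ _)).
have ov2 x y : dep x y -> maxn (size (proj x y a1)) (size (proj x y a2))
     + maxn (size (proj x y b1)) (size (proj x y b2)) + 2 * size (proj x y g2)
     <= size (proj x y h).
  move=> d; rewrite (Hh _ _ d) (maxnC (size (proj x y a1))) (maxnC (size (proj x y b1))).
  apply: (overlap (teq_sym Hh) cd2 (size_gt0 _ pr2)).
  rewrite (maxnC (size a2)) (maxnC (size b2)) -(size_teq Hh); apply: Hsz.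
  by rewrite !inE eqxx orbT.
have [t1 [t2 [Ht disj]]] := teq_join Hh; pose A := a1 ++ t1.
have sh1 x y : size (proj x y h)
    = size (proj x y a1) + (n1 * size (proj x y g1) + size (proj x y b1)).
  by rewrite !proj_cat proj_wpow !size_cat size_wpow.
have sh2 x y : dep x y -> size (proj x y h)
    = size (proj x y a2) + (n2 * size (proj x y g2) + size (proj x y b2)).
  by move=> d; rewrite (Hh _ _ d) !proj_cat proj_wpow !size_cat size_wpow.
have projA x y : dep x y -> prefix (proj x y A) (proj x y h) /\
    size (proj x y A) <= maxn (size (proj x y a1)) (size (proj x y a2)).
  move=> d; case: (disj _ _ d) => E.
    by rewrite proj_cat E cats0 leq_maxl proj_cat prefix_prefix.
  by rewrite (Ht _ _ d) (Hh _ _ d) proj_cat E cats0 leq_maxr proj_cat prefix_prefix.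
(* Averaging [ov1] and [ov2] leaves room after [A] for one copy of each period. *)
have fit x y : dep x y ->
    [/\ size (proj x y A) + (size (proj x y g1) + size (proj x y g2))
          <= size (proj x y a1) + n1 * size (proj x y g1),
        size (proj x y A) + (size (proj x y g1) + size (proj x y g2))
          <= size (proj x y a2) + n2 * size (proj x y g2) &
        size (proj x y A) + (size (proj x y g1) + size (proj x y g2))
          <= size (proj x y h)].
  move=> d; have [_] := projA _ _ d; have := ov1 x y; have := ov2 _ _ d.
  have := sh1 x y; have := sh2 _ _ d; rewrite -/h; split; lia.
have [||c1 [Hc1 per1]] := @conjugate_period a1 g1 n1 b1 h A t1 (@teq_refl h) (@teq_refl A).
- by move=> x y /projA[].
- by move=> x y /fit[le _ _]; apply: leq_trans le; exact: leq_addr.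
have [||c2 [Hc2 per2]] := @conjugate_period a2 g2 n2 b2 h A t2 Hh Ht.
- by move=> x y /projA[].
- by move=> x y /fit[_ le _]; apply: leq_trans le; exact: leq_addr.
have cnt1 x : cnt x c1 = cnt x g1.
  by have := cnt_teq x Hc1; rewrite !cnt_cat addnC => /addnI.
have cnt2 x : cnt x c2 = cnt x g2.
  by have := cnt_teq x Hc2; rewrite !cnt_cat addnC => /addnI.
(* In each projection, the window [w] that follows [A] in [h] has both periods and their total
   length. *)
have C : teq (c1 ++ c2) (c2 ++ c1).
  move=> x y d; rewrite !proj_cat; have [f1 f2 f3] := fit _ _ d; have [pA _] := projA _ _ d.
  case/prefixP: pA => r Er; pose w := take (size (proj x y g1) + size (proj x y g2)) r.
  have sw : size w = size (proj x y g1) + size (proj x y g2).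
    by apply: size_takel; move: f3; rewrite Er size_cat leq_add2l.
  have pw : prefix (proj x y A ++ w) (proj x y h) by rewrite Er prefix_cat2 prefix_take.
  apply: (@periods_commute _ _ w).
  - by apply: per1 => //; rewrite sw.
  - by apply: per2 => //; rewrite sw.
  - by rewrite sw !size_proj !cnt1 !cnt2.
(* A generator in only one period would, by the other decomposition, occur in [h] only within the
   outer factors, too rarely for [ov1] or [ov2]. *)
have Esupp x : (0 < cnt x c1) = (0 < cnt x c2).
  have d := dep_refl x; rewrite cnt1 cnt2; have := ov1 x x; have := ov2 _ _ d.
  have := sh1 x x; have := sh2 _ _ d; rewrite -/h !size_proj eqxx !addn0.
  case: (posnP (cnt x g1)) => [->|p1]; case: (posnP (cnt x g2)) => [->|p2] //;
    rewrite ?muln0; lia.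
have cdc : connected_dominating c1.
  case: cd1 => conn dom; split=> [x y|y]; last first.
    by have [s] := dom y; rewrite -cnt1; exists s.
  rewrite !cnt1 => px py; rewrite (eq_connect (e' := fun a b => [&& e a b, 0 < cnt a g1
    & 0 < cnt b g1])); first exact: conn.
  by move=> a b; rewrite !cnt1.
have [t [i [j [Hi Hj]]]] := teq_commute C (proportional_cnt C cdc Esupp).
have i1 : i = 1 by apply: primitive_conj pr1 (weq_teq Hc1) (weq_teq Hi).
have j1 : j = 1 by apply: primitive_conj pr2 (weq_teq Hc2) (weq_teq Hj).
have E12 : teq c1 c2 by rewrite i1 in Hi; rewrite j1 in Hj; apply: teq_trans Hi (teq_sym Hj).
(* Conjugation by [a ++ u] carries [c] to [a ++ g ++ winv a]; in both decompositions [a ++ u]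
   represents the join [A]. *)
have conjA (a g u c : word T) : teq (g ++ u) (u ++ c) ->
    weq e ((a ++ g ++ winv a) ++ (a ++ u)) ((a ++ u) ++ c).
  move=> Hc; rewrite catA; apply: weq_trans (weq_cat (weq_conj_cat _ _) (weq_refl _)) _.
  by rewrite -!catA; apply: weq_cat (weq_refl _) (weq_teq Hc).
have HA : weq e A (a2 ++ t2) by exact: weq_teq.
apply: weq_trans (weq_conjP (conjA a1 _ _ _ Hc1)) _; apply: weq_sym; apply: weq_conjP.
apply: weq_trans (weq_cat (weq_refl _) HA) _; apply: weq_trans (conjA a2 _ _ _ Hc2) _.
exact: weq_cat (weq_sym HA) (weq_sym (weq_teq E12)).
Qed.

Lemma weq_cancell u v w : weq e (u ++ v) (u ++ w) -> weq e v w.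
Proof.
move=> H; have K r : weq e (winv u ++ u ++ r) r.
  by rewrite catA; exact: (weq_cat (weq_Vmul u) (weq_refl r)).
apply: weq_trans (weq_sym (K v)) _; apply: weq_trans (K w).
exact: weq_cat (weq_refl _) H.
Qed.

(** Both sides equal [a ++ wpow g n.+1 ++ b]. Conjugation by [h] thus derives the second conclusion
    of the theorem from the first. *)
Lemma weq_conj_shift (h a g b : word T) n : weq e h (a ++ wpow g n ++ b) ->
  weq e (h ++ winv b ++ g ++ b) ((a ++ g ++ winv a) ++ h).
Proof.
move=> H; apply: (@weq_trans (a ++ wpow g n.+1 ++ b)).
  apply: weq_trans (weq_cat H (weq_refl _)) _; rewrite wpowSr -!catA.
  do 2 apply: weq_cat (weq_refl _) _.
  by rewrite catA; exact: (weq_cat (weq_mulV b) (weq_refl _)).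
apply: weq_sym; apply: weq_trans (weq_cat (weq_refl _) H) _.
rewrite catA; apply: weq_trans (weq_cat (weq_conj_cat _ _) (weq_refl _)) _.
by rewrite /= -!catA; exact: weq_refl.
Qed.

(** A generator neither in the support nor adjacent to it would disjointly commute with [g]. *)
Lemma connected_dominating_reduced g g' : weq e g g' -> reduced e g' ->
  strongly_non_split e g -> connected_dominating g'.
Proof.
move=> H rg [ns dom]; have S x := @supp_reduced g g' x H rg; split=> [x y|y].
  rewrite -!S => px py; rewrite (eq_connect (e' := fun a b => [&& e a b, supp e g a
    & supp e g b])); first exact: ns.
  by move=> a b; rewrite !S.
case: (classic (exists2 s, 0 < cnt s g' & dep y s)) => // nd; case: (dom y) => y' s.
move/supp_letter => -> /=; rewrite S => ps; apply/andP; rewrite -negb_or.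
by apply/negP => d; apply: nd; exists s.
Qed.

End Traces.

(** * The numerical bound and the theorem *)

Import Order.TTheory GRing.Theory Num.Theory.
Local Open Scope ring_scope.

(** The outer factors take at most [2 * lam * h]; what is left is at least [(1 - 2 * lam) * N * g],
    hence at least [(2 * V + 1) * g]. *)
Lemma quasi_root_middle (R : realFieldType) (lam : R) (V N n : nat) (a1 a2 b1 b2 g h : nat) :
  lam < 1 / 2 -> ((2 * V + 1)%N)%:R / (1 - 2 * lam) <= N%:R ->
  a1%:R <= lam * h%:R -> a2%:R <= lam * h%:R ->
  b1%:R <= lam * h%:R -> b2%:R <= lam * h%:R ->
  (N <= n)%N -> (n * g <= h)%N ->
  (maxn a1 a2 + maxn b1 b2 + (2 * V + 1) * g <= h)%N.
Proof.
move=> lam2 HN Ha1 Ha2 Hb1 Hb2 Nn ngh.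
have pos : 0 < 1 - 2 * lam by lra.
rewrite ler_pdivrMr // in HN.
have Ha : (maxn a1 a2)%:R <= lam * h%:R by case: leqP.
have Hb : (maxn b1 b2)%:R <= lam * h%:R by case: leqP.
have Hg : N%:R * g%:R <= h%:R :> R.
  by rewrite -natrM ler_nat (leq_trans _ ngh) // leq_mul2r Nn orbT.
rewrite -(ler_nat R) !natrD natrM.
have H1 : (2 * V + 1)%:R * g%:R <= N%:R * (1 - 2 * lam) * g%:R by rewrite ler_wpM2r.
have H2 : (1 - 2 * lam) * (N%:R * g%:R) <= (1 - 2 * lam) * h%:R by rewrite ler_wpM2l // ltW.
have H3 : N%:R * (1 - 2 * lam) * g%:R = (1 - 2 * lam) * (N%:R * g%:R) by ring.
lra.
Qed.

Theorem theorem1p9 (T : finType) (e : rel T)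
  (e_sym : symmetric e) (e_irr : irreflexive e)
  (e_conn : forall x y : T, connect e x y)
  (R : realFieldType) (lam : R) (hlam0 : 0 <= lam) (hlam1 : lam < 1 / 2)
  (N : nat) (hN2 : (2 <= N)%N)
  (hN : ((2 * #|T| + 1)%N)%:R / (1 - 2 * lam) <= N%:R)
  (h a1 g1 b1 a2 g2 b2 : word T) (n1 n2 : nat) :
  quasi_root_dec e lam N h a1 g1 b1 n1 ->
  quasi_root_dec e lam N h a2 g2 b2 n2 ->
  strongly_non_split e g1 -> primitive e g1 ->
  strongly_non_split e g2 -> primitive e g2 ->
  weq e (a1 ++ g1 ++ winv a1) (a2 ++ g2 ++ winv a2) /\
  weq e (winv b1 ++ g1 ++ b1) (winv b2 ++ g2 ++ b2).

Proof.
move=> [Nn1 w1 l1 la1 lb1] [Nn2 w2 l2 la2 lb2] sns1 pr1 sns2 pr2.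
have rep w : exists w', [/\ weq e w w', reduced e w' & size w' = wlen e w].
  by have [w' H1 H2] := wlen_rep e w; exists w'; rewrite /reduced -(wlen_weq H1).
(* Shortest representatives of [a], [g] and [b] are chosen; the geodesic condition makes the whole
   concatenation reduced, as [reduced_teq] requires. *)
have reph a g b n : weq e h (a ++ wpow g n ++ b) ->
    wlen e h = (wlen e a + n * wlen e g + wlen e b)%N ->
    exists a' g' b', [/\ weq e a a', weq e g g', weq e b b' &
      [/\ reduced e g', size a' = wlen e a, size g' = wlen e g, size b' = wlen e b &
      [/\ weq e h (a' ++ wpow g' n ++ b'), reduced e (a' ++ wpow g' n ++ b') &
          size (a' ++ wpow g' n ++ b') = wlen e h]]].
  move=> wh lh; have [[a' [wa _ sa]] [g' [wg rg sg]]] := (rep a, rep g).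
  have [b' [wb _ sb]] := rep b; exists a', g', b'; split=> //; split=> //.
  have wh' : weq e h (a' ++ wpow g' n ++ b').
    apply: weq_trans wh _; apply: weq_cat wa _; apply: weq_cat _ wb; exact: weq_wpow.
  have sh : size (a' ++ wpow g' n ++ b') = wlen e h.
    by rewrite !size_cat size_wpow sa sg sb lh addnA.
  by split=> //; rewrite /reduced sh; exact: wlen_weq.
have [a1' [g1' [b1' [wa1 wg1 wb1 [rg1 sa1 sg1 sb1 [wh1 rh1 sh1]]]]]] := reph _ _ _ _ w1 l1.
have [a2' [g2' [b2' [wa2 wg2 wb2 [rg2 sa2 sg2 sb2 [wh2 rh2 sh2]]]]]] := reph _ _ _ _ w2 l2.
have prim_weq g g' : weq e g g' -> primitive e g -> primitive e g'.
  move=> H [nt pg]; split=> [H'|u n n_ge2 H']; first by apply: nt; exact: weq_trans H'.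
  by apply: (pg u n n_ge2); exact: weq_trans H'.
have conj_weq a g a' g' : weq e a a' -> weq e g g' ->
    weq e (a ++ g ++ winv a) (a' ++ g' ++ winv a').
  move=> Ha Hg; apply: weq_conjP.
  apply: weq_trans (weq_cat (weq_refl _ _) (weq_sym Ha)) _.
  apply: weq_trans (weq_conj_cat _ _ _) _; exact: weq_cat.
have Ea : weq e (a1 ++ g1 ++ winv a1) (a2 ++ g2 ++ winv a2).
  apply: weq_trans (conj_weq _ _ _ _ wa1 wg1) _.
  apply: weq_trans _ (weq_sym (conj_weq _ _ _ _ wa2 wg2)).
  apply: (@quasi_roots_conjugate _ _ e_sym a1' g1' b1' a2' g2' b2' n1 n2).
  - exact (reduced_teq e_sym rh1 rh2 (weq_trans (weq_sym wh1) wh2)).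
  - exact: (connected_dominating_reduced e_sym wg1).
  - exact: (connected_dominating_reduced e_sym wg2).
  - move=> g; rewrite !inE sh1 sa1 sa2 sb1 sb2 => /orP[]/eqP ->; rewrite ?sg1 ?sg2.
      by apply: (quasi_root_middle hlam1 hN) Nn1 _ => //; rewrite l1; lia.
    by apply: (quasi_root_middle hlam1 hN) Nn2 _ => //; rewrite l2; lia.
  - exact: prim_weq pr1.
  - exact: prim_weq pr2.
split=> //; apply: (@weq_cancell _ _ h).
apply: weq_trans (weq_conj_shift w1) _; apply: weq_trans _ (weq_sym (weq_conj_shift w2)).
exact: weq_cat Ea (weq_refl _ _).
Qed.
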